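(* Let $n \ge 3$ and $R \subseteq \{2,\ldots,n-1\}$. If $S$ is a Hamilton sequence for the restricted rotator graph $\mathrm{Rot}_{n-1}(R)$ whose last two entries are both $n-1$, then for every $m \in \{2,3,\ldots,n\}$, $\mathrm{rewind}_m(S)$ (formed with parameter $n$) is a Hamilton sequence for the restricted incomplete rotator graph $\mathrm{Rot}_n(R \cup \{n\}, m)$.
   Context: $\Pi_k$ is the set of strings that are permutations of $\{1,\ldots,k\}$. For $2 \le r \le k$, the prefix-rotation $\sigma_r$ maps $a_1 \cdots a_k$ to $a_2 \cdots a_r a_1 a_{r+1} \cdots a_k$. For $R \subseteq \{2,\ldots,k\}$ and $m \in \{1,\ldots,k\}$, $\mathrm{Rot}_k(R,m)$ is the directed graph whose nodes are the strings of $\Pi_k$ whose last symbol is at most $m$, with an arc from $\mathbf{a}$ to $\mathbf{b}$ whenever both are nodes and $\mathbf{b} = \mathbf{a}\sigma_r$ for some $r \in R$; $\mathrm{Rot}_k(R) = \mathrm{Rot}_k(R,k)$. A Hamilton sequence for such a graph with $N$ nodes is a sequence $r_1,\ldots,r_N$ of elements of $R$ such that, with $v_0 = k\,(k{-}1)\cdots 1$ and $v_i = v_{i-1}\sigma_{r_i}$, the strings $v_0,\ldots,v_{N-1}$ are pairwise distinct and are exactly the nodes, and $v_N = v_0$. Rewind operation: writing $S = T, n{-}1, n{-}1$, $\mathrm{rewind}_m(S)$ is the concatenation of: $T, n{-}1, n$; then $m-2$ copies of the block $T, n$; then $T, n{-}1, n$; then $m-2$ copies of $n$. *)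

(* Defs.v *)
From mathcomp Require Import all_boot.

Set Implicit Arguments.
Unset Strict Implicit.
Unset Printing Implicit Defensive.

(* Strings are sequences of symbols numbered from 1. *)
Definition is_perm_string (k : nat) (a : seq nat) : bool :=
  perm_eq a (iota 1 k).

Definition prefix_rot (r : nat) (a : seq nat) : seq nat :=
  rot 1 (take r a) ++ drop r a.

(* The directed graph Rot_k(R, m); Rot_k(R) is the case m = k.  The set R is
   given by its membership predicate. *)
Definition Rot_node (k m : nat) : pred (seq nat) :=
  [pred a | is_perm_string k a & last 0 a <= m].

Definition Rot_arc (k : nat) (R : pred nat) (m : nat) (a b : seq nat) : Prop :=
  [/\ a \in Rot_node k m, b \in Rot_node k m &
      exists2 r, r \in R & b = prefix_rot r a].

Definition start_string (k : nat) : seq nat := rev (iota 1 k).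

(* The string v_i reached from v_0 = k (k-1) ... 1 after the first i
   rotations of s. *)
Definition rot_walk (k : nat) (s : seq nat) (i : nat) : seq nat :=
  foldl (fun a r => prefix_rot r a) (start_string k) (take i s).

(* The number N of nodes is not a parameter: size s = N follows from the
   second and third clauses. *)
Definition hamilton_seq (k : nat) (R : pred nat) (m : nat) (s : seq nat)
    : Prop :=
  [/\ {subset s <= R},
      uniq (mkseq (rot_walk k s) (size s)),
      mkseq (rot_walk k s) (size s) =i Rot_node k m &
      rot_walk k s (size s) = start_string k].

Lemma hamilton_seq_arc (k : nat) (R : pred nat) (m : nat) (s : seq nat) :
  hamilton_seq k R m s ->
  forall i, i < size s ->
    Rot_arc k R m (rot_walk k s i) (rot_walk k s i.+1).
Proof.
case=> sR _ sN sE i lt_i.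
have nodeP j : j < size s -> rot_walk k s j \in Rot_node k m.
  by move=> lt_j; rewrite -sN; apply: map_f; rewrite mem_iota.
split; first exact: nodeP.
- have [/nodeP //|le_s] := ltnP i.+1 (size s).
  have -> : i.+1 = size s by apply/eqP; rewrite eqn_leq lt_i.
  rewrite sE; have -> : start_string k = rot_walk k s 0.
    by rewrite /rot_walk take0.
  by apply: nodeP; apply: leq_ltn_trans lt_i.
- exists (nth 0 s i); first by apply/sR/mem_nth.
  by rewrite /rot_walk (take_nth 0 lt_i) -cats1 foldl_cat.
Qed.

(* Meaningful when s = T, n-1, n-1; then take (size s - 2) s is T. *)
Definition rewind (n m : nat) (s : seq nat) : seq nat :=
  let T := take (size s - 2) s in
  (T ++ [:: n.-1; n]) ++ flatten (nseq (m - 2) (T ++ [:: n])) ++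
  (T ++ [:: n.-1; n]) ++ nseq (m - 2) n.

(* Main.v *)
(** Strings ending in a fixed symbol x form a relabelled copy of Rot_(n-1)(R),
    which T traverses with all but its last node visited.  Following
    T, n-1, n exhausts the strings ending in x, whereas T, n misses one string
    and moves on to the strings ending in x+1.  After the strings ending in
    m are exhausted, the rotations by n run backwards through the missed
    strings, ending in m-1, ..., 2, and return to the start. *)
Require Import Defs.
From mathcomp Require Import all_boot.

Set Implicit Arguments.
Unset Strict Implicit.
Unset Printing Implicit Defensive.

(** * Walks from an arbitrary string *)

Definition rot_run (a s : seq nat) : seq nat :=
  foldl (fun a r => prefix_rot r a) a s.

(** The final string is left out, so that the traces of consecutive pieces concatenate. *)
Definition rot_trace (a s : seq nat) : seq (seq nat) :=
  mkseq (fun i => rot_run a (take i s)) (size s).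

Lemma rot_run_cat a s1 s2 : rot_run a (s1 ++ s2) = rot_run (rot_run a s1) s2.
Proof. exact: foldl_cat. Qed.

Lemma rot_trace_cons a r s :
  rot_trace a (r :: s) = a :: rot_trace (prefix_rot r a) s.
Proof. by rewrite /rot_trace /mkseq /= -[1]/(1 + 0) iotaDl -map_comp. Qed.

Lemma rot_trace_cat a s1 s2 :
  rot_trace a (s1 ++ s2) = rot_trace a s1 ++ rot_trace (rot_run a s1) s2.
Proof.
elim: s1 a => // r s1 IH a.
by rewrite cat_cons !rot_trace_cons IH.
Qed.

Lemma size_prefix_rot r a : size (prefix_rot r a) = size a.
Proof. by rewrite /prefix_rot size_cat size_rot -size_cat cat_take_drop. Qed.

Lemma prefix_rot_size a : prefix_rot (size a) a = rot 1 a.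
Proof. by rewrite /prefix_rot take_size drop_size cats0. Qed.

Lemma prefix_rot_map (g : nat -> nat) r a :
  prefix_rot r (map g a) = map g (prefix_rot r a).
Proof. by rewrite /prefix_rot map_cat map_rot map_take map_drop. Qed.

Lemma prefix_rot_rcons r a x :
  r <= size a -> prefix_rot r (rcons a x) = rcons (prefix_rot r a) x.
Proof.
move=> le_r; rewrite /prefix_rot -cats1 takel_cat // drop_cat -cats1 -catA.
case: ltngtP le_r => // -> _.
by rewrite subnn drop0 drop_size.
Qed.

Lemma rot_run_map (g : nat -> nat) a s :
  rot_run (map g a) s = map g (rot_run a s).
Proof. by elim: s a => //= r s IH a; rewrite prefix_rot_map IH. Qed.

Lemma rot_trace_map (g : nat -> nat) a s :
  rot_trace (map g a) s = map (map g) (rot_trace a s).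
Proof.
elim: s a => // r s IH a.
by rewrite !rot_trace_cons prefix_rot_map IH.
Qed.

Lemma size_rot_run a s : size (rot_run a s) = size a.
Proof. by elim: s a => //= r s IH a; rewrite IH size_prefix_rot. Qed.

Lemma rot_run_rcons a x s :
  {in s, forall r, r <= size a} ->
  rot_run (rcons a x) s = rcons (rot_run a s) x.
Proof.
elim: s a => //= r s IH a les; rewrite prefix_rot_rcons ?les ?mem_head // IH //.
by move=> q s_q; rewrite size_prefix_rot les // inE s_q orbT.
Qed.

Lemma rot_trace_rcons a x s :
  {in s, forall r, r <= size a} ->
  rot_trace (rcons a x) s = [seq rcons b x | b <- rot_trace a s].
Proof.
elim: s a => // r s IH a les; rewrite !rot_trace_cons.
rewrite prefix_rot_rcons ?les ?mem_head // IH //.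
by move=> q s_q; rewrite size_prefix_rot les // inE s_q orbT.
Qed.

(** * Relabelling the symbols *)

Lemma uniq_map_inj_in (T1 T2 : eqType) (g : T1 -> T2) (s : seq T1) :
  uniq (map g s) -> {in s &, injective g}.
Proof.
elim: s => //= z s IH /andP[gz /IH inj] x y; rewrite !inE.
move=> /predU1P[->|sx] /predU1P[->|sy] // eqg; last exact: inj.
- by case/negP: gz; rewrite eqg map_f.
- by case/negP: gz; rewrite -eqg map_f.
Qed.

(** By counting: the left list is duplicate-free, contained in the right one, and of the same
    size. *)
Lemma perm_permutations_map (g : nat -> nat) (s : seq nat) :
  uniq s -> {in s &, injective g} ->
  perm_eq (map (map g) (permutations s)) (permutations (map g s)).
Proof.
move=> s_uniq g_inj.
have sub: {subset map (map g) (permutations s) <= permutations (map g s)}.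
  move=> _ /mapP[b + ->]; rewrite !mem_permutations; exact: perm_map.
have u: uniq (map (map g) (permutations s)).
  rewrite map_inj_in_uniq ?permutations_uniq // => b c.
  rewrite !mem_permutations => /perm_mem sb /perm_mem sc eqbc.
  by apply: (inj_in_map g_inj) eqbc; apply/allP => i; rewrite ?sb ?sc.
have [|_ eq_m] := uniq_min_size u sub.
  by rewrite size_map !size_permutations ?map_inj_in_uniq // size_map.
apply: uniq_perm => //; exact: permutations_uniq.
Qed.

Lemma start_string_relabel k a : size a = k ->
  exists g : nat -> nat, a = map g (start_string k).
Proof.
(* In [start_string k] the symbol [j] stands at position [k - j]. *)
move=> sz; exists (fun j => nth 0 a (k - j)); rewrite /start_string map_rev.
apply: (@eq_from_nth _ 0); rewrite ?size_rev ?size_map ?size_iota // sz.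
move=> i lt_i; rewrite nth_rev size_map size_iota //.
have lt': k - i.+1 < k by rewrite ltn_subrL (leq_ltn_trans _ lt_i).
by rewrite (nth_map 0) ?size_iota // nth_iota // add1n subnSK // subKn 1?ltnW.
Qed.

(** Prefix rotations act on positions and commute with relabelling, so a Hamilton sequence closes up
    and visits everything from any start with distinct symbols. *)
Lemma hamilton_seq_relabel k R s a :
  hamilton_seq k R k s -> uniq a -> size a = k ->
  rot_run a s = a /\ perm_eq (rot_trace a s) (permutations a).
Proof.
case=> _ u_tr tr_nodes run_s a_uniq sz.
have [g def_a] := start_string_relabel sz.
have run_s' : rot_run (start_string k) s = start_string k.
  by rewrite -[RHS]run_s /rot_walk take_size.
have v0_uniq: uniq (start_string k) by rewrite rev_uniq iota_uniq.
split; first by rewrite def_a rot_run_map run_s'.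
rewrite def_a rot_trace_map.
apply: (@perm_trans _ (map (map g) (permutations (start_string k)))).
  apply/perm_map/uniq_perm; rewrite ?permutations_uniq // => b.
  rewrite mem_permutations perm_sym perm_rev perm_sym tr_nodes inE.
  rewrite /is_perm_string; case: (boolP (perm_eq b _)) => //= p.
  (* The last symbol is one of [1, ..., k], so the bound in [Rot_node] holds. *)
  case: b p => [|y b] // p; have := mem_last y b.
  by rewrite (perm_mem p) mem_iota add1n ltnS => /andP[].
apply: perm_permutations_map => //.
by apply: uniq_map_inj_in; rewrite -def_a.
Qed.

(** * Entry strings, missed strings and blocks *)

Definition desc (x l : nat) : seq nat := rev (iota x l).

Lemma descS x l : desc x l.+1 = rcons (desc x.+1 l) x.
Proof. by rewrite /desc /= rev_cons. Qed.

Lemma desc_recl x l : desc x l.+1 = x + l :: desc x l.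
Proof. by rewrite /desc -addn1 iotaD rev_cat. Qed.

(* The first string ending in x = i + 2 on the walk, without its last symbol,
   where n = x + l. *)
Definition entry (i l : nat) : seq nat :=
  rcons (desc 1 i ++ desc i.+3 l) i.+1.

(* The string ending in x = i + 1 that T, n misses, without its last symbol,
   where n = x + l. *)
Definition missed (i l : nat) : seq nat := desc 1 i ++ desc i.+2 l.

Definition block (n x : nat) : seq (seq nat) :=
  [seq rcons b x | b <- permutations (rem x (iota 1 n))].

Lemma perm_missed i l : perm_eq (missed i l) (rem i.+1 (iota 1 (i + l.+1))).
Proof.
rewrite -(perm_cons i.+1); have i_in : i.+1 \in iota 1 (i + l.+1).
  by rewrite mem_iota /= add1n ltnS -addSnnS leq_addr.
apply: perm_trans (perm_to_rem i_in); rewrite iotaD add1n /=.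
rewrite -cat1s perm_catCA /=.
by apply: perm_cat; rewrite ?perm_cons perm_rev.
Qed.

(** The missed string is the one from which a rotation by [n-1] would lead back to the entry. *)
Lemma rotr_entry i l : rotr 1 (entry i l) = missed i.+1 l.
Proof. by rewrite /entry rotr1_rcons /missed desc_recl add1n. Qed.

(** One step of the return: a rotation by [n] links the missed strings of consecutive blocks. *)
Lemma rot_missed i l :
  rot 1 (rcons (missed i.+1 l) i.+2) = rcons (missed i l.+1) i.+1.
Proof. by rewrite /missed desc_recl add1n /= rot1_cons descS rcons_cat. Qed.

Lemma start_missed n : start_string n.+1 = rcons (missed 0 n) 1.
Proof. exact: descS. Qed.

Lemma perm_entry i l : perm_eq (entry i l) (missed i.+1 l).
Proof. by rewrite -rotr_entry perm_sym perm_rot. Qed.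

Lemma uniq_missed i l : uniq (missed i l).
Proof. by rewrite (perm_uniq (perm_missed i l)) rem_uniq // iota_uniq. Qed.

Lemma size_missed i l : size (missed i l) = i + l.
Proof. by rewrite size_cat !size_rev !size_iota. Qed.

(** * Walks through one block and through consecutive blocks *)

(** Bookkeeping for a missed string [c]: it is visited after all of [B], but belongs to the block
    begun by [A]. *)
Lemma perm_cat_rcons (T : eqType) (A B X Y : seq T) c :
  perm_eq (rcons A c) X -> perm_eq B Y -> perm_eq (A ++ B ++ [:: c]) (X ++ Y).
Proof.
move=> pX pB; rewrite (perm_catl _ (_ : perm_eq _ ([:: c] ++ B))).
  by rewrite catA cats1 perm_cat.
by rewrite perm_catC.
Qed.

Lemma rot_run_full a n : size a = n -> rot_run a [:: n] = rot 1 a.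
Proof. by move=> <-; exact: prefix_rot_size. Qed.

(** Here [n] is the length without the last symbol [x], which no entry of [s] moves. Since [s] leads
    back to [a], undoing its last two full rotations of [a] gives the strings reached by [T ++
    [:: n]] and by [T]. *)
Lemma sub_walk n (R : pred nat) (s T a : seq nat) (x : nat) :
  (forall r : nat, r \in R -> r <= n) ->
  s = T ++ [:: n; n] -> hamilton_seq n R n s -> uniq a -> size a = n ->
  [/\ rot_run (rcons a x) (T ++ [:: n]) = rcons (rotr 1 a) x,
      rot_run (rcons a x) T = rcons (rotr 1 (rotr 1 a)) x &
      perm_eq (rcons (rot_trace (rcons a x) (T ++ [:: n]))
                 (rcons (rotr 1 a) x))
              [seq rcons b x | b <- permutations a]].
Proof.
move=> hR def_s hs a_uniq sz.
have [run_a tr_a] := hamilton_seq_relabel hs a_uniq sz.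
have les : {in s, forall r, r <= size a}.
  by case: hs => sR _ _ _ r /sR /hR; rewrite sz.
have def_s' : s = (T ++ [:: n]) ++ [:: n] by rewrite def_s -catA.
have lesT : {in T, forall r, r <= size a}.
  by move=> r Tr; apply: les; rewrite def_s mem_cat Tr.
have lesTn : {in T ++ [:: n], forall r, r <= size a}.
  by move=> r Tr; apply: les; rewrite def_s' mem_cat Tr.
have run_n b : rot_run a (b ++ [:: n]) = rot 1 (rot_run a b).
  by rewrite rot_run_cat rot_run_full // size_rot_run.
have runTn : rot_run a (T ++ [:: n]) = rotr 1 a.
  by apply: (canRL (rotK 1)); rewrite -run_n -def_s'.
have runT : rot_run a T = rotr 1 (rotr 1 a).
  by apply: (canRL (rotK 1)); rewrite -run_n.
split; first by rewrite rot_run_rcons // runTn.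
  by rewrite rot_run_rcons // runT.
rewrite -runTn -rot_run_rcons // -cats1.
(* A one-step trace is just its starting string, so the appended string completes the trace of
   [s]. *)
rewrite -[X in _ ++ X]/(rot_trace _ [:: n]) -rot_trace_cat -def_s'.
by rewrite rot_trace_rcons // perm_map.
Qed.

(* The walk through the strings ending in i+2, ..., i+j+2, entered by [entry]
   and left through the missed string ending in i+1. *)
Fixpoint climb (n : nat) (T : seq nat) (j : nat) : seq nat :=
  if j is j'.+1 then (T ++ [:: n]) ++ climb n T j' ++ [:: n]
  else T ++ [:: n.-1; n].

(** The rotations by [n] closing the nested levels collect at the end, as in [rewind]. *)
Lemma climbE n T j :
  climb n T j =
  flatten (nseq j (T ++ [:: n])) ++ (T ++ [:: n.-1; n]) ++ nseq j n.
Proof.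
elim: j => [|j IH] /=; first by rewrite cats0.
by rewrite IH -!catA -[[:: n]]/(nseq 1 n) -nseqD addn1.
Qed.

Lemma climb_subset n (R : pred nat) (T : seq nat) j :
  {subset T <= R} -> n.-1 \in R -> {subset climb n T j <= [predU1 n & R]}.
Proof.
move=> TR Rn r; elim: j => [|j IH] /=; rewrite !(mem_cat, inE).
  by case/or3P=> [/TR-> | /eqP-> | ->]; rewrite ?orbT // Rn orbT.
by case/or3P=> [/orP[/TR-> | ->] | /IH | ->] //; rewrite ?orbT.
Qed.

(** Lets [T, n] and [T, n-1] be exchanged when only the visited strings matter. *)
Lemma rot_trace_last a t r q :
  rot_trace a (t ++ [:: r]) = rot_trace a (t ++ [:: q]).
Proof. by rewrite !rot_trace_cat. Qed.

(** After [T] the symbol [i+3] stands in front, so a rotation by [n] enters the next block. *)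
Lemma rot_entry_step i l :
  rot 1 (rcons (rotr 1 (missed i.+1 l.+1)) i.+2) = rcons (entry i.+1 l) i.+3.
Proof.
rewrite /missed /entry (descS _ l) -rcons_cat rotr1_rcons.
by rewrite rcons_cons rot1_cons.
Qed.

Lemma perm_block (a : seq nat) i l : perm_eq a (missed i l) ->
  perm_eq [seq rcons b i.+1 | b <- permutations a] (block (i + l.+1) i.+1).
Proof.
move=> pa; apply/perm_map/perm_permutations.
exact: perm_trans pa (perm_missed i l).
Qed.

Lemma walk_entry n (R : pred nat) (s T : seq nat) (i l : nat) :
  (forall r : nat, r \in R -> r <= n.-1) ->
  s = T ++ [:: n.-1; n.-1] -> hamilton_seq n.-1 R n.-1 s ->
  n = i.+1 + l.+1 ->
  let a := rcons (entry i l) i.+2 in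
  [/\ rot_run a (T ++ [:: n.-1]) = rcons (missed i.+1 l) i.+2,
      rot_run a T = rcons (rotr 1 (missed i.+1 l)) i.+2 &
      perm_eq (rcons (rot_trace a (T ++ [:: n.-1]))
                 (rcons (missed i.+1 l) i.+2))
              (block n i.+2)].
Proof.
move=> hR def_s hs def_n; have perm_e := perm_entry i l.
have e_uniq : uniq (entry i l) by rewrite (perm_uniq perm_e) uniq_missed.
have sz : size (entry i l) = n.-1.
  by rewrite (perm_size perm_e) size_missed def_n addnS.
have [] := sub_walk i.+2 hR def_s hs e_uniq sz.
rewrite rotr_entry => runTn runT tr; split=> //.
by apply: perm_trans tr _; rewrite def_n; apply: perm_block.
Qed.

(** Induction on [j]: [T, n] visits all but the missed string of the first block, the inner climb
    covers the later blocks and comes down to that string, and the closing [n] leaves it. The bound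
    [j <= l] keeps the last symbols at most [n]. *)
Lemma climb_walk n (R : pred nat) (s T : seq nat) (i j l : nat) :
  (forall r : nat, r \in R -> r <= n.-1) ->
  s = T ++ [:: n.-1; n.-1] -> hamilton_seq n.-1 R n.-1 s ->
  j <= l -> n = i.+1 + l.+1 ->
  rot_run (rcons (entry i l) i.+2) (climb n T j) =
    rcons (missed i l.+1) i.+1 /\
  perm_eq (rot_trace (rcons (entry i l) i.+2) (climb n T j))
    (flatten [seq block n y | y <- iota i.+2 j.+1]).
Proof.
move=> hR def_s hs; elim: j i l => [|j IH] i l le_jl def_n;
  have [runTn runT tr] := walk_entry hR def_s hs def_n;
  have sz_m : size (rcons (missed i.+1 l) i.+2) = n
    by rewrite size_rcons size_missed def_n addnS.
- rewrite /climb -[[:: _; _]]/([:: n.-1] ++ [:: n]) catA.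
  rewrite rot_trace_cat rot_run_cat runTn rot_run_full //.
  split; first exact: rot_missed.
  by rewrite -[rot_trace _ [:: n]]/[:: _] cats1 [flatten _]cats0.
case: l => // l in le_jl def_n runTn runT tr sz_m *.
have [//||run_j tr_j] := IH i.+1 l; first by rewrite def_n addnS.
have run_up : rot_run (rcons (entry i l.+1) i.+2) (T ++ [:: n]) =
    rcons (entry i.+1 l) i.+3.
  rewrite rot_run_cat runT rot_run_full ?rot_entry_step //.
  by rewrite size_rcons size_rotr -sz_m size_rcons.
rewrite [climb _ _ _]/= rot_run_cat run_up rot_run_cat run_j.
split; first by rewrite rot_run_full ?rot_missed.
rewrite rot_trace_cat run_up (rot_trace_cat _ (climb _ _ _)) run_j.
by rewrite (rot_trace_last _ _ _ n.-1); apply: perm_cat_rcons.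
Qed.

(** * Assembling the blocks into a Hamilton cycle *)

Lemma blocks_nodes n m :
  0 < m <= n ->
  uniq (flatten [seq block n y | y <- iota 1 m]) /\
  flatten [seq block n y | y <- iota 1 m] =i Rot_node n m.
Proof.
case/andP=> m_gt0 le_mn; split.
  apply: (@allpairs_uniq_dep _ (fun=> seq nat) _ (fun y b => rcons b y)
            (iota 1 m) (fun y => permutations (rem y (iota 1 n)))).
  - exact: iota_uniq.
  - by move=> y _; apply: permutations_uniq.
  - by move=> [y b] [z c] _ _ /= /rcons_inj [-> ->].
move=> c; rewrite inE; apply/flatten_mapP/andP => [[y]|[pc le_c]].
  rewrite mem_iota add1n => /andP[y_gt0 le_ym] /mapP[b].
  rewrite mem_permutations => pb ->; rewrite last_rcons; split=> //.
  have y_in : y \in iota 1 n.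
    by rewrite mem_iota y_gt0 add1n ltnS (leq_trans _ le_mn).
  rewrite /is_perm_string perm_sym.
  apply: perm_trans (perm_to_rem y_in) _.
  by rewrite perm_sym perm_rcons perm_cons.
(* The empty string, with default last symbol 0, passes the bound; it is excluded by its length, as
   [n] is positive. *)
case/lastP: c => [|b y] in pc le_c *.
  by have := perm_size pc; rewrite size_iota => n0;
    rewrite -n0 leqNgt m_gt0 in le_mn.
rewrite last_rcons in le_c.
have y_in : y \in iota 1 n by rewrite -(perm_mem pc) mem_rcons mem_head.
have y_gt0 : 0 < y by move: y_in; rewrite mem_iota => /andP[].
exists y; first by rewrite mem_iota y_gt0 add1n ltnS.
apply: map_f; rewrite mem_permutations -(perm_cons y) -perm_rcons.
exact: perm_trans pc (perm_to_rem y_in).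
Qed.

Theorem theorem6 (n : nat) (hn : 3 <= n)
    (R : pred nat) (hR : forall r : nat, r \in R -> 2 <= r <= n.-1)
    (s T : seq nat) (hs : s = T ++ [:: n.-1; n.-1])
    (hham : hamilton_seq n.-1 R n.-1 s)
    (m : nat) (hm : 2 <= m <= n) :
  hamilton_seq n [predU1 n & R] m (rewind n m s).
Proof.
have hR' r : r \in R -> r <= n.-1 by case/hR/andP.
(* The first piece exhausts block 1, the single [n] enters block 2, and the climb covers blocks
   [2, ..., m]. *)
have def_rw : rewind n m s = (T ++ [:: n.-1]) ++ [:: n] ++ climb n T (m - 2).
  by rewrite /rewind hs size_cat addnK take_size_cat // climbE -!catA.
case: n hn hR hs hham hm hR' def_rw => [|[|l]] // hn hR hs hham.
case: m => [|[|j]] // /andP[_ le_jl] hR' ->; rewrite 2!subSS subn0.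
have sz : size (missed 0 l.+1) = l.+1 by rewrite size_missed.
(* Block 1 is walked from the start string, which has the form of a missed string; so the descent of
   the climb ends exactly there. *)
have [runTn _ tr] := sub_walk 1 hR' hs hham (uniq_missed 0 l.+1) sz.
have run_up : rot_run (rcons (rotr 1 (missed 0 l.+1)) 1) [:: l.+2] =
    rcons (entry 0 l) 2.
  rewrite rot_run_full ?size_rcons ?size_rotr ?sz //.
  by rewrite /missed descS rotr1_rcons rcons_cons rot1_cons.
have [//|//|run_j tr_j] := @climb_walk l.+2 R s T 0 j l hR' hs hham.
set w := _ ++ _ ++ _.
have run_w : rot_run (start_string l.+2) w = start_string l.+2.
  by rewrite {1}start_missed rot_run_cat runTn rot_run_cat run_up run_j
             start_missed.
have tr_w : perm_eq (rot_trace (start_string l.+2) w)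
    (flatten [seq block l.+2 y | y <- iota 1 j.+2]).
  rewrite start_missed rot_trace_cat runTn (rot_trace_cat _ [:: _]) run_up.
  (* The string from which the single [n] departs is the last one of block 1. *)
  rewrite catA [_ ++ rot_trace _ [:: _]]cats1.
  exact: perm_cat (perm_trans tr (perm_block (perm_refl _))) tr_j.
have [//|u_bl mem_bl] := @blocks_nodes l.+2 j.+2.
split.
- have [sR _ _ _] := hham.
  have TR : {subset T <= R} by move=> r Tr; rewrite sR // hs mem_cat Tr.
  have Rn : l.+1 \in R by rewrite sR // hs mem_cat mem_head orbT.
  move=> r; rewrite /w !mem_cat !mem_seq1 => /or3P[|/eqP->|].
  + by case/orP=> [/TR rR | /eqP->]; rewrite inE ?rR ?Rn orbT.
  + by rewrite inE eqxx.
  + exact: climb_subset.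
- by rewrite (perm_uniq tr_w).
- by move=> c; rewrite (perm_mem tr_w) mem_bl.
- by rewrite /rot_walk take_size.
Qed.
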